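(* Let $p\ge 1$, let $n_1,\dots,n_p\ge1$ and $k_s\in[n_s]$ for each $s$. If there exists a non-trivially intersecting family $\mathcal{F}\subseteq\prod_{s}\binom{[n_s]}{k_s}$, then there exists a non-trivially intersecting family $\mathcal{F}'\subseteq\prod_{s}\binom{[n_s]}{k_s}$ of maximum size (among all non-trivially intersecting subfamilies of $\prod_{s}\binom{[n_s]}{k_s}$) which is shifted.
   Context: Multi-part setting: the ground set is the disjoint union $\bigsqcup_{s=1}^p [n_s]$ of $p$ parts, where $[n]=\{1,\dots,n\}$. For $F_s\subseteq[n_s]$, $\bigsqcup_s F_s$ denotes the subset of the ground set having $F_s$ in part $s$; $\prod_{s}\binom{[n_s]}{k_s}$ is the collection of all sets $\bigsqcup_s F_s$ with $|F_s|=k_s$ for all $s$. A family is intersecting if any two of its sets intersect (in some part); trivially intersecting if some element (in some part) lies in all of its sets; non-trivially intersecting if intersecting but not trivially intersecting. Shifting: for $t\in[p]$, $1\le i<j\le n_t$ and $F=\bigsqcup_s F_s\in\prod_s\binom{[n_s]}{k_s}$, define $S_t^{i,j}(F)=F$ if $i\in F_t$ or $j\notin F_t$, and otherwise $S_t^{i,j}(F)$ is obtained from $F$ by replacing $F_t$ with $(F_t\setminus\{j\})\cup\{i\}$. For a family $\mathcal F\subseteq\prod_s\binom{[n_s]}{k_s}$, define $S_t^{i,j}(\mathcal F)=\{S_t^{i,j}(F):F\in\mathcal F\}\cup\{F: F\in\mathcal F \text{ and } S_t^{i,j}(F)\in\mathcal F\}$ (a $t$-shift of $\mathcal F$). $\mathcal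 F$ is $t$-shifted if $S_t^{i,j}(\mathcal F)=\mathcal F$ for all $1\le i<j\le n_t$, and shifted if it is $t$-shifted for every $t\in[p]$. *)

(* Defs.v *)
From mathcomp Require Import all_boot.
Set Implicit Arguments. Unset Strict Implicit. Unset Printing Implicit Defensive.

(* Ground set: disjoint union of parts [n_s], s in 'I_p; element i of part s
   is the tagged pair (s, i) with i : 'I_(n s) (i.e. [n_s] relabelled as
   {0,...,n_s - 1}). *)
Section MultiPart.
Variables (p : nat) (n : 'I_p -> nat).

Definition ground := {s : 'I_p & 'I_(n s)}.
Definition elt (s : 'I_p) (i : 'I_(n s)) : ground := Tagged (fun s => 'I_(n s)) i.

Definition part (F : {set ground}) (s : 'I_p) : {set 'I_(n s)} :=
  [set i | elt i \in F].

Definition in_prod (k : 'I_p -> nat) (F : {set ground}) : bool :=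
  [forall s, #|part F s| == k s].

Definition subfam_prod (k : 'I_p -> nat) (fam : {set {set ground}}) : bool :=
  [forall F in fam, in_prod k F].

Definition intersecting (fam : {set {set ground}}) : Prop :=
  forall F G, F \in fam -> G \in fam -> F :&: G != set0.

Definition trivially_intersecting (fam : {set {set ground}}) : Prop :=
  exists x : ground, forall F, F \in fam -> x \in F.

Definition nontrivially_intersecting (fam : {set {set ground}}) : Prop :=
  intersecting fam /\ ~ trivially_intersecting fam.

Definition shift_set (t : 'I_p) (i j : 'I_(n t)) (F : {set ground}) : {set ground} :=
  if (elt i \in F) || (elt j \notin F) then F
  else elt i |: (F :\ elt j).

Definition shift_fam (t : 'I_p) (i j : 'I_(n t)) (fam : {set {set ground}})
  : {set {set ground}} :=
  (shift_set i j @: fam) :|: [set F in fam | shift_set i j F \in fam].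

Definition t_shifted (t : 'I_p) (fam : {set {set ground}}) : Prop :=
  forall i j : 'I_(n t), i < j -> shift_fam i j fam = fam.

Definition shifted (fam : {set {set ground}}) : Prop :=
  forall t : 'I_p, t_shifted t fam.

End MultiPart.

(* Main.v *)
(* Take a non-trivially intersecting family of maximum size and, among those, of
   minimum total weight.  A shift exchanging x and y (same part, x first) that
   does not fix the family must make it trivial; then every member avoiding x
   contains y, and exchanging y for x leaves the family.  Call (x, y) blocked.

   A family stable under all shifts off a set Z contains, with any two members
   of equal part sizes off Z, two members with the same traces on Z that
   coincide off Z.  With Z = {x, y} this contradicts blockedness of (x, y), so a
   second blocked pair exists.  Disjoint blocked pairs lie in different parts s
   with k_s = 1: otherwise maximality supplies a set through x and y that defeats
   the other pair.  With Z the union of two blocked pairs, maximality again gives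
   a contradiction, so there is a third.  Three blocked pairs bound the size of
   the family by that of the family of all sets containing at least two of three
   first elements of parts, which is shifted and non-trivially intersecting. *)
Require Import Defs.
From mathcomp Require Import all_boot.
Set Implicit Arguments. Unset Strict Implicit. Unset Printing Implicit Defensive.

Section Shifting.
Variables (p : nat) (n k : 'I_p -> nat).
Notation ground := (ground n).
Implicit Types (x y z : ground) (F G H : {set ground}).
Implicit Types (fam : {set {set ground}}).

(** * Part sizes, order and weight on the ground set *)

Definition idx z : nat := tagged z.
(** A sum instead of the cardinal of [part F s], so that exchanges and set differences are handled
    by additivity. *)
Definition count F s := \sum_(z in F) (tag z == s).
Definition below x y := (tag x == tag y) && (idx x < idx y).
(** The operation [shift_set] on ground elements instead of indices of a fixed part, which avoids
    dependent types; that both elements lie in one part is left to [below]. *)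
Definition shift x y F := if (x \in F) || (y \notin F) then F else x |: (F :\ y).
Definition weight F := \sum_(z in F) idx z.
Definition fweight fam := \sum_(F in fam) weight F.

Lemma below_neq x y : below x y -> x != y.
Proof. by case/andP=> _; apply: contraTneq => ->; rewrite ltnn. Qed.

Lemma below_total x y : tag x = tag y -> x != y -> below x y || below y x.
Proof.
rewrite /below => exy; rewrite exy eqxx /= -neq_ltn; apply: contraNneq.
case: x y exy => [s i] [t j] /= est; case: _ / est j => j.
by rewrite /idx /= => /val_inj ->.
Qed.

Lemma card_part F s : #|part F s| = count F s.
Proof.
rewrite /count -big_mkcondr /= sum1_card -(card_imset (part F s) (f := @elt p n s)).
  apply: eq_card => z; rewrite [RHS]unfold_in; apply/imsetP/andP.
    by case=> i iF ->; rewrite inE in iF; rewrite iF /= eqxx.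
  case: z => t i /= [zF /eqP ets]; case: _ / ets zF => iF.
  by exists i; rewrite // inE.
by move=> i j /eqP; rewrite /elt eq_Tagged => /eqP.
Qed.

Lemma in_prodP F : reflect (forall s, count F s = k s) (in_prod k F).
Proof. by apply: (iffP forallP) => h s; move: (h s); rewrite card_part => /eqP. Qed.

Lemma count_gt0 F z s : tag z = s -> z \in F -> 0 < count F s.
Proof. by move=> <- zF; rewrite /count (big_setD1 z) //= eqxx. Qed.

Lemma count_gt1 F y z s :
  tag y = s -> tag z = s -> y \in F -> z \in F -> y != z -> 1 < count F s.
Proof.
move=> <- etz yF zF nyz; rewrite /count (big_setD1 y) //= (big_setD1 z) /=.
  by rewrite etz eqxx.
by rewrite !inE eq_sym nyz.
Qed.

Lemma count_swap F x y s : tag x = tag y -> x \notin F -> y \in F ->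
  count (x |: (F :\ y)) s = count F s.
Proof.
move=> exy xF yF; rewrite /count big_setU1 /= ?(big_setD1 y yF) /= ?exy //.
by rewrite !inE (negbTE xF) andbF.
Qed.

Lemma shift_moved x y F : x \notin F -> y \in F -> shift x y F = x |: (F :\ y).
Proof. by rewrite /shift => /negbTE -> ->. Qed.

Lemma count_shift x y F s : tag x = tag y -> count (shift x y F) s = count F s.
Proof.
rewrite /shift; case: ifP => // /norP[xF]; rewrite negbK => yF exy.
exact: count_swap.
Qed.

Lemma weight_shift x y F : below x y -> shift x y F != F ->
  weight (shift x y F) < weight F.
Proof.
case/andP=> _ lt; rewrite /shift; case: ifP => [_|]; rewrite ?eqxx //.
move=> /norP[xF]; rewrite negbK => yF _.
rewrite /weight big_setU1 ?inE ?(negbTE xF) ?andbF //= (big_setD1 y yF) /=.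
by rewrite ltn_add2r.
Qed.

(** * Non-trivial intersection as a boolean predicate *)

Definition nontriv fam :=
  [&& [forall F in fam, in_prod k F],
      [forall F in fam, forall G in fam, F :&: G != set0] &
      [forall x, exists F in fam, x \notin F]].

Lemma nontrivP fam :
  reflect [/\ forall F, F \in fam -> in_prod k F,
              forall F G, F \in fam -> G \in fam -> F :&: G != set0 &
              forall x, exists2 F, F \in fam & x \notin F]
          (nontriv fam).
Proof.
apply: (iffP and3P) => [[/forall_inP h1 /forall_inP h2 /forallP h3]|[h1 h2 h3]].
  by split=> // [F G /h2 /forall_inP h /h|x] //; apply/exists_inP.
split; first exact/forall_inP.
  by apply/forall_inP => F hF; apply/forall_inP => G; apply: h2.
by apply/forallP => x; apply/exists_inP.
Qed.

Lemma nontrivE fam :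
  nontriv fam <-> subfam_prod k fam /\ nontrivially_intersecting fam.
Proof.
split=> [/nontrivP[h1 h2 h3]|[/forall_inP h1 [h2 h3]]].
  split; first exact/forall_inP.
  split=> // [[x hx]]; have [F /hx xF] := h3 x; by rewrite xF.
apply/nontrivP; split=> // x; apply/exists_inP; apply: contra_notT h3.
move=> /exists_inPn h; exists x => F /h; by rewrite negbK.
Qed.

(** * Shifts of families *)

Definition shiftf x y fam :=
  (shift x y @: fam) :|: [set F in fam | shift x y F \in fam].
(** The shift of a family as a map on its members: [F] moves unless its shift is already present. *)
Definition fshift x y fam F := if shift x y F \in fam then F else shift x y F.

Lemma shift_idem x y F : shift x y (shift x y F) = shift x y F.
Proof. by rewrite {2 3}/shift; case: ifP => h; rewrite /shift ?h // setU11. Qed.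

Lemma shiftfE x y fam : shiftf x y fam = fshift x y fam @: fam.
Proof.
apply/setP=> G; rewrite !inE; apply/orP/imsetP => [[/imsetP[F hF ->]|/andP[hG h]]|].
- case h: (shift x y F \in fam); last by exists F; rewrite /fshift ?h.
  by exists (shift x y F); rewrite /fshift ?shift_idem ?h.
- by exists G; rewrite /fshift ?h.
case=> F hF ->; rewrite /fshift; case: ifP => h; last by left; apply: imset_f.
by right; rewrite hF.
Qed.

Lemma shiftf_id x y fam :
  (forall F, F \in fam -> shift x y F \in fam) -> shiftf x y fam = fam.
Proof.
move=> h; rewrite shiftfE -[RHS]imset_id; apply: eq_in_imset => F hF.
by rewrite /fshift h.
Qed.

(** A moved member is recovered by exchanging [x] back for [y], and its image lies outside [fam],
    whereas members that stay have their image in [fam]. *)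
Lemma fshift_inj x y fam : {in fam &, injective (fshift x y fam)}.
Proof.
have moved F : F \in fam -> shift x y F \notin fam ->
    F = y |: (shift x y F :\ x).
  rewrite /shift; case: ifP => [_ -> //|/norP[xF]]; rewrite negbK => yF _ _.
  apply/setP=> z; rewrite !inE; case: (eqVneq z y) => [->|] //=.
  by case: (eqVneq z x) => [->|] //=; rewrite (negbTE xF).
move=> F G hF hG; rewrite /fshift.
case: ifP => [|/negbT] sF; case: ifP => [|/negbT] sG // e.
- by rewrite -e hF in sG.
- by rewrite e hG in sF.
by rewrite (moved F) // (moved G) // e.
Qed.

Lemma shiftf_intersecting x y fam : x != y ->
  (forall F G, F \in fam -> G \in fam -> F :&: G != set0) ->
  forall F G, F \in shiftf x y fam -> G \in shiftf x y fam -> F :&: G != set0.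
Proof.
move=> nxy hI.
have mixed F G : F \in fam -> G \in fam -> shift x y F \notin fam ->
    shift x y G \in fam -> shift x y F :&: G != set0.
  move=> hF hG; rewrite {1 3}/shift; case: ifP => [_|]; first by rewrite hF.
  move=> /norP[xF]; rewrite negbK => yF _ sG.
  case xG: (x \in G); first by apply/set0Pn; exists x; rewrite !inE eqxx xG.
  case yG: (y \in G); last first.
    have /set0Pn[z] := hI _ _ hF hG; rewrite inE => /andP[zF zG].
    apply/set0Pn; exists z; rewrite !inE zF zG andbT.
    by rewrite (contraNneq _ (negbT yG)) ?orbT // => <-.
  (* Now [G] contains [y] but not [x]: [F] meets the shift of [G], and the common element is neither
     [x] nor [y], so it survives in both sets. *)
  rewrite shift_moved ?xG // in sG.
  have /set0Pn[z] := hI _ _ hF sG; rewrite !inE => /andP[zF].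
  case: (eqVneq z x) => [e|_ /= /andP[nzy zG]]; first by rewrite -e zF in xF.
  by apply/set0Pn; exists z; rewrite !inE zF zG nzy orbT.
move=> F' G'; rewrite shiftfE => /imsetP[F hF ->] /imsetP[G hG ->] {F' G'}.
rewrite /fshift.
case: ifP => [|/negbT] sF; case: ifP => [|/negbT] sG.
- exact: hI.
- by rewrite setIC; apply: mixed.
- exact: mixed.
have xS H : H \in fam -> shift x y H \notin fam -> x \in shift x y H.
  by move=> hH; rewrite /shift; case: ifP; rewrite ?hH // setU11.
by apply/set0Pn; exists x; rewrite inE !xS.
Qed.

(** * Extremal families and blocked pairs *)

Definition extremal fam :=
  [/\ nontriv fam, forall fam', nontriv fam' -> #|fam'| <= #|fam| &
      forall fam', nontriv fam' -> #|fam'| = #|fam| -> fweight fam <= fweight fam'].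

Lemma extremal_exists fam : nontriv fam -> exists fam', extremal fam'.
Proof.
move=> h0; case: (arg_maxnP (fun f : {set {set ground}} => #|f|) h0) => f1 h1 max1.
have h1' : nontriv f1 && (#|f1| == #|f1|) by rewrite h1 /=.
pose P f := nontriv f && (#|f| == #|f1|).
case: (arg_minnP (P := P) fweight h1') => f2 /andP[h2 /eqP c2] min2.
exists f2; split=> // [f' h'|f' h' e]; first by rewrite c2; apply: max1.
by apply: min2; rewrite /P h' e c2 /=.
Qed.

(** Adding [H] would otherwise give a larger non-trivially intersecting family; being non-empty, [H]
    meets itself. *)
Lemma extremal_mem fam H : extremal fam -> in_prod k H -> H != set0 ->
  (forall F, F \in fam -> F :&: H != set0) -> H \in fam.
Proof.
case=> /nontrivP[hP hI hN] hmax _ pH H0 hH; apply: contraT => nH.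
have := hmax (H |: fam); rewrite cardsU1 nH ltnn; apply.
apply/nontrivP; split.
- by move=> F; rewrite !inE => /predU1P[->|/hP].
- move=> F G; rewrite !inE => /predU1P[->|hF] /predU1P[->|hG].
  + by rewrite setIid.
  + by rewrite setIC; apply: hH.
  + exact: hH.
  + exact: hI.
- by move=> x; have [F hF xF] := hN x; exists F; rewrite // inE hF orbT.
Qed.

Definition blocked fam x y := below x y /\
  forall F, F \in fam -> x \notin F -> y \in F /\ x |: (F :\ y) \notin fam.

Lemma shift_or_blocked fam x y : extremal fam -> below x y ->
  {in fam, forall F, shift x y F \in fam} \/ blocked fam x y.
Proof.
move=> [/nontrivP[hP hI hN] _ hmin] lxy.
have nxy := below_neq lxy; have /andP[/eqP exy _] := lxy.
have cardS : #|shiftf x y fam| = #|fam|.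
  by rewrite shiftfE (card_in_imset (@fshift_inj x y fam)).
case hS: (nontriv (shiftf x y fam)); [left=> F hF|right; split=> // F hF xF].
  (* The shifted family has the same size, and no member gains weight; if [F] moved, the total
     weight would drop below the minimum. *)
  apply: contraT => sF; move: (hmin _ hS cardS).
  rewrite leqNgt => /negP[]; rewrite /fweight shiftfE.
  rewrite big_imset /=; last exact: fshift_inj.
  have le G : weight (fshift x y fam G) <= weight G.
    rewrite /fshift; case: ifP => // _; have [-> //|ne] := eqVneq (shift x y G) G.
    by apply/ltnW/weight_shift.
  rewrite (big_setD1 F) //= [X in _ < X](big_setD1 F) //= -addSn leq_add //.
    rewrite /fshift (negbTE sF); apply: weight_shift => //.
    by apply: contraNneq sF => ->.
  by apply: leq_sum => G _.
(* Part sizes and intersection survive the shift, so only non-triviality can fail. The common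
   element is [x]: for any other [z], a member of [fam] avoiding [z] has a shift avoiding [z]. *)
have all_x G : G \in shiftf x y fam -> x \in G.
  have : ~~ [forall z, exists G in shiftf x y fam, z \notin G].
    apply: contraFN hS => /forallP h; apply/nontrivP; split.
    - move=> G'; rewrite shiftfE => /imsetP[G0 /hP /in_prodP pG0 ->].
      by apply/in_prodP => s; rewrite /fshift; case: ifP => _; rewrite ?count_shift.
    - exact: shiftf_intersecting.
    - by move=> z; apply/exists_inP; exact: h.
  case/forallPn => z /exists_inPn hz hG; have := hz _ hG; rewrite negbK.
  suff <- : z = x by [].
  apply: contraTeq isT => nzx; have [H hH zH] := hN z.
  have := hz (shift x y H); rewrite inE imset_f //= => /(_ isT).
  rewrite negbK /shift; case: ifP => _; rewrite ?(negbTE zH) //.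
  by rewrite !inE (negbTE nzx) (negbTE zH) andbF.
have yF : y \in F.
  have : x \in shift x y F by apply: all_x; rewrite inE imset_f.
  by apply: contraLR => yF; rewrite /shift yF orbT.
split=> //; apply: (contraNN _ xF) => sF; apply: all_x.
by rewrite !inE hF (shift_moved xF yF) sF orbT.
Qed.

(** * Families stable under shifts off a given set *)

Definition stable_off (Z : {set ground}) fam :=
  [forall x, forall y, [&& below x y, x \notin Z & y \notin Z] ==>
     [forall F in fam, shift x y F \in fam]].

Lemma stable_or_blocked Z fam : extremal fam -> ~~ stable_off Z fam ->
  exists x y, [/\ blocked fam x y, x \notin Z & y \notin Z].
Proof.
move=> ext /forallPn[x /forallPn[y]]; rewrite negb_imply.
case/andP=> /and3P[lxy xZ yZ] /forall_inP nst; exists x, y; split=> //.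
by have [h|] := shift_or_blocked ext lxy.
Qed.

Lemma count_setD F Z s : count F s = count (F :&: Z) s + count (F :\: Z) s.
Proof. by rewrite /count (big_setID Z). Qed.

Lemma count_exists F G s : count F s = count G s ->
  forall x, x \in F -> x \notin G -> tag x = s ->
  exists2 y, y \in G :\: F & tag y = s.
Proof.
move=> ec x xF xG ex.
have : 0 < count (G :\: F) s.
  have : 0 < count (F :\: G) s by apply: (count_gt0 ex); rewrite inE xG.
  suff -> : count (G :\: F) s = count (F :\: G) s by [].
  by apply: (@addnI (count (F :&: G) s)); rewrite -count_setD setIC -count_setD ec.
rewrite lt0n sum_nat_eq0 negb_forall => /existsP[y]; rewrite negb_imply eqb0 negbK.
by case/andP=> yG /eqP; exists y.
Qed.

(* Minimising the weight over the members with a given trace on [Z] makes the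
   part of the member outside [Z] canonical. *)
Lemma stable_confluence Z fam F G : stable_off Z fam ->
  F \in fam -> G \in fam ->
  (forall s, count (F :\: Z) s = count (G :\: Z) s) ->
  exists F' G', [/\ F' \in fam, G' \in fam, F' :&: Z = F :&: Z,
     G' :&: Z = G :&: Z & F' :\: Z = G' :\: Z].
Proof.
move=> st hF hG ec.
pose P E := [pred E' | [&& E' \in fam, E' :&: Z == E :&: Z &
   [forall s, count (E' :\: Z) s == count (E :\: Z) s]]].
have PE E : E \in fam -> P E E.
  by move=> hE /=; rewrite hE eqxx; apply/forallP=> s /=.
(* A lowering exchange off [Z] stays in the class [P E], so a member of minimum weight admits
   none. *)
have step E x y H : P E H -> (forall H', P E H' -> weight H <= weight H') ->
    below x y -> x \notin Z -> y \notin Z -> x \notin H -> y \in H -> False.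
  move=> /and3P[hH /eqP eZ /forallP ct] mn lxy xZ yZ xH yH.
  have ne : shift x y H != H.
    by apply: (contraNneq _ xH) => <-; rewrite shift_moved // setU11.
  have := weight_shift lxy ne; rewrite ltnNge mn //=.
  have /andP[/eqP exy _] := lxy.
  have hS : shift x y H \in fam.
    by move/forallP/(_ x)/forallP/(_ y): st; rewrite lxy xZ yZ /= => /forall_inP; apply.
  have SZ : shift x y H :&: Z = H :&: Z.
    rewrite shift_moved //; apply/setP=> z; rewrite !inE.
    case: (eqVneq z x) => [->|_] /=; first by rewrite (negbTE xZ) !andbF.
    by case: (eqVneq z y) => [->|_] //=; rewrite (negbTE yZ) !andbF.
  rewrite hS SZ eZ eqxx /=; apply/forallP=> s.
  have := count_shift H s exy; rewrite (count_setD _ Z) SZ.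
  by rewrite [in RHS](count_setD _ Z) => /addnI ->.
case: (arg_minnP weight (PE F hF)) => F' PF' minF.
case: (arg_minnP weight (PE G hG)) => G' PG' minG.
exists F', G'; have /and3P[hF' /eqP eF /forallP cF] := PF'.
have /and3P[hG' /eqP eG /forallP cG] := PG'; split=> //.
have ecs s : count (F' :\: Z) s = count (G' :\: Z) s.
  by rewrite (eqP (cF s)) (eqP (cG s)).
(* Of two elements in one part, each lying in only one of the sets, the lower could replace the
   other in the set lacking it, against [step]. *)
have clash x y : x \in F' :\: Z -> x \notin G' :\: Z ->
    y \in G' :\: Z -> y \notin F' :\: Z -> tag y = tag x -> False.
  rewrite !inE => /andP[xZ xF]; rewrite xZ /= => xG /andP[yZ yG].
  rewrite yZ /= => yF e.
  have nyx : y != x by apply: contraNneq yF => ->.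
  by have /orP[l|l] := below_total e nyx;
    [apply: (step _ _ _ _ PF' minF l)|apply: (step _ _ _ _ PG' minG l)].
apply/setP=> z; case zF: (z \in F' :\: Z); case zG: (z \in G' :\: Z) => //.
  have [y /setDP[yG yF] e] := count_exists (ecs _) zF (negbT zG) erefl.
  by case: (clash z y); rewrite ?zG.
have [y /setDP[yF yG] e] := count_exists (esym (ecs _)) zG (negbT zF) erefl.
by case: (clash y z); rewrite ?zF.
Qed.

(** * Blocked pairs force further blocked pairs *)

(** A member avoiding [x] contains [y], and one avoiding [y] contains [x], so their counts off the
    pair agree. Confluence makes them coincide there; exchanging [y] for [x] in the first then gives
    the second, which is forbidden. *)
Lemma blocked_not_stable fam x y :
  extremal fam -> blocked fam x y -> ~~ stable_off [set x; y] fam.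
Proof.
case=> /nontrivP[hP hI hN] _ _ [lxy hB]; apply/negP => st.
have nxy := below_neq lxy; have /andP[/eqP exy _] := lxy.
have [F hF xF] := hN x; have [yF _] := hB _ hF xF.
have [G hG yG] := hN y.
have xG : x \in G by apply: contraNT yG => /(hB _ hG)[].
have FZ : F :&: [set x; y] = [set y].
  apply/setP=> z; rewrite !inE; case: (eqVneq z x) => [->|_] /=.
    by rewrite (negbTE xF) (negbTE nxy).
  by case: (eqVneq z y) => [->|]; rewrite ?andbF ?yF.
have GZ : G :&: [set x; y] = [set x].
  apply/setP=> z; rewrite !inE; case: (eqVneq z x) => [->|_] /=.
    by rewrite xG.
  by case: (eqVneq z y) => [->|]; rewrite ?andbF ?(negbTE yG).
have [s|F' [G' [hF' hG' F'Z G'Z eZ]]] := stable_confluence st hF hG.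
  move/in_prodP/(_ s): (hP _ hF); move/in_prodP/(_ s): (hP _ hG) => <-.
  rewrite (count_setD F [set x; y]) (count_setD G [set x; y]) FZ GZ /count !big_set1.
  by rewrite exy => /addnI.
have xF' : x \notin F'.
  move/setP/(_ x): F'Z; rewrite FZ !inE eqxx /= andbT => ->; exact: nxy.
have [_ /negP[]] := hB _ hF' xF'.
suff -> : x |: F' :\ y = G' by [].
apply/setP=> z; move/setP/(_ z): eZ; move/setP/(_ z): G'Z; rewrite GZ !inE.
case: (eqVneq z x) => [_|_] /=; first by rewrite andbT => ->.
by case: (eqVneq z y) => //= _; rewrite andbT => ->.
Qed.

Lemma count_gt1_exists F y s : 1 < count F s -> y \in F ->
  exists z, [/\ z \in F, z != y & tag z = s].
Proof.
move=> h yF; move: h; rewrite /count (big_setD1 y) //=; set r := \sum_(z in _) _ => h.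
have : 0 < r by move: h; case: (tag y == s); case: r.
rewrite lt0n sum_nat_eq0 negb_forall => /existsP[z].
rewrite negb_imply eqb0 negbK !inE => /andP[/andP[nzy zF] /eqP e]; by exists z.
Qed.

(** Every member meets [[set x; y]], so by maximality every product set containing both is a member.
    If the part size were at least 2, some such set would avoid [x']; exchanging its [y'] for [x']
    keeps [x] and [y], so it remains a member, against the second pair. *)
Lemma blocked_part_size1 fam x y x' y' : extremal fam ->
  blocked fam x y -> blocked fam x' y' ->
  x' \notin [set x; y] -> y' \notin [set x; y] -> k (tag x) = 1.
Proof.
move=> ext [lxy hB] [lxy' hB']; rewrite !inE !negb_or.
move=> /andP[nx'x nx'y] /andP[ny'x ny'y].
have /andP[/eqP exy _] := lxy; have /andP[/eqP exy' _] := lxy'.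
have [/nontrivP[hP hI hN] _ _] := ext.
have [F0 hF0 xF0] := hN x; have [yF0 _] := hB _ hF0 xF0.
have kpos : 0 < k (tag x).
  by move/in_prodP: (hP _ hF0) => <-; apply: (count_gt0 (esym exy)).
apply/eqP; rewrite eqn_leq kpos andbT leqNgt; apply/negP => k2.
have mem H : in_prod k H -> x \in H -> y \in H -> H \in fam.
  move=> pH xH yH; apply: (extremal_mem ext pH) => [|F hF].
    by apply/set0Pn; exists x.
  case xF: (x \in F); first by apply/set0Pn; exists x; rewrite inE xF.
  by have [yF _] := hB _ hF (negbT xF); apply/set0Pn; exists y; rewrite inE yF.
have swap H u v : in_prod k H -> tag u = tag v -> u \notin H -> v \in H ->
    in_prod k (u |: (H :\ v)).
  by move=> /in_prodP pH e uH vH; apply/in_prodP=> s; rewrite count_swap.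
(* Start from a member avoiding [x']; if it has only one of [x] and [y], a second element [z] of
   that part makes room for the other. *)
have [H [pH xH yH x'H]] : exists H, [/\ in_prod k H, x \in H, y \in H & x' \notin H].
  have [F hF x'F] := hN x'; have pF := hP _ hF; have /in_prodP cF := pF.
  case xF: (x \in F); case yF: (y \in F).
  - by exists F.
  - have k2F : 1 < count F (tag x) by rewrite cF.
    have [z [zF nzx ez]] := count_gt1_exists k2F xF.
    exists (y |: (F :\ z)); split; rewrite ?setU11 //.
    + by apply: swap; rewrite ?yF ?ez.
    + by rewrite !inE xF (eq_sym x z) nzx orbT.
    + by rewrite !inE (negbTE x'F) (negbTE nx'y) andbF.
  - have k2F : 1 < count F (tag x) by rewrite cF.
    have [z [zF nzy ez]] := count_gt1_exists k2F yF.
    exists (x |: (F :\ z)); split; rewrite ?setU11 //.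
    + by apply: swap; rewrite ?xF ?ez.
    + by rewrite !inE yF (eq_sym y z) nzy orbT.
    + by rewrite !inE (negbTE x'F) (negbTE nx'x) andbF.
  - by have [] := hB _ hF (negbT xF); rewrite yF.
have [y'H /negP[]] := hB' _ (mem _ pH xH yH) x'H.
apply: mem; first exact: swap.
  by rewrite !inE xH (eq_sym x y') ny'x orbT.
by rewrite !inE yH (eq_sym y y') ny'y orbT.
Qed.

Lemma in_prod_uniq H y z s : in_prod k H -> k s = 1 -> tag y = s -> tag z = s ->
  y \in H -> z \in H -> y = z.
Proof.
move=> /in_prodP/(_ s) cH ks ey ez yH zH; apply: contraTeq isT => nyz.
by have := count_gt1 ey ez yH zH nyz; rewrite cH ks.
Qed.

(** In a common part of size 1, a member avoiding [x] would have [y] as its only element there, yet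
    contain [x'] or [y']. *)
Lemma blocked_pairs fam x y x' y' : extremal fam ->
  blocked fam x y -> blocked fam x' y' ->
  x' \notin [set x; y] -> y' \notin [set x; y] ->
  [/\ k (tag x) = 1, k (tag x') = 1 & tag x != tag x'].
Proof.
move=> ext b b' d1 d2; have k1 := blocked_part_size1 ext b b' d1 d2.
split=> //.
  apply: (blocked_part_size1 ext b' b); move: d1 d2; rewrite !inE !negb_or.
    by rewrite (eq_sym x' x) (eq_sym y' x) => /andP[-> _] /andP[->].
  by rewrite (eq_sym x' y) (eq_sym y' y) => /andP[_ ->] /andP[_ ->].
move: d1 d2; rewrite !inE !negb_or => /andP[nx'x nx'y] /andP[ny'x ny'y].
apply/eqP => e; have [/nontrivP[hP _ hN] _ _] := ext.
have [lxy hB] := b; have [lxy' hB'] := b'.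
have /andP[/eqP exy _] := lxy; have /andP[/eqP exy' _] := lxy'.
have [F hF xF] := hN x; have [yF _] := hB _ hF xF.
case x'F: (x' \in F).
  have := in_prod_uniq (hP _ hF) k1 (esym exy) (esym e) yF x'F.
  by move/eqP; rewrite eq_sym (negbTE nx'y).
have [y'F _] := hB' _ hF (negbT x'F).
have ey' : tag y' = tag x by rewrite -exy'.
have := in_prod_uniq (hP _ hF) k1 (esym exy) ey' yF y'F.
by move/eqP; rewrite eq_sym (negbTE ny'y).
Qed.

(** The aim is two members containing [y] but not [x], one with [x'] and the other with [y'].
    Confluence makes them coincide off the four elements, so they differ by exchanging [y'] for
    [x'], which is forbidden. *)
Lemma blocked2_not_stable fam x y x' y' : extremal fam ->
  blocked fam x y -> blocked fam x' y' ->
  x' \notin [set x; y] -> y' \notin [set x; y] ->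
  ~~ stable_off [set x; y; x'; y'] fam.
Proof.
move=> ext b b' d1 d2; have [k1 k1' nt] := blocked_pairs ext b b' d1 d2.
move: d1 d2; rewrite !inE !negb_or => /andP[nx'x nx'y] /andP[ny'x ny'y].
apply/negP=> st; set Z := [set x; y; x'; y'] in st.
have [/nontrivP[hP hI hN] _ _] := ext.
have [lxy hB] := b; have [lxy' hB'] := b'.
have nxy := below_neq lxy; have nxy' := below_neq lxy'.
have /andP[/eqP exy _] := lxy; have /andP[/eqP exy' _] := lxy'.
have key A B : A \in fam -> B \in fam -> x \notin A -> y \in A -> x' \in A ->
    y' \notin A -> x \notin B -> y \in B -> x' \notin B -> y' \in B -> False.
  move=> hA hB0 xA yA x'A y'A xB yB x'B y'B.
  have AZ : A :&: Z = [set y; x'].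
    apply/setP=> z; rewrite !inE; case: (eqVneq z x) => [->|_] /=.
      by rewrite (negbTE xA) (negbTE nxy) eq_sym (negbTE nx'x).
    case: (eqVneq z y) => [->|_] /=; first by rewrite yA.
    case: (eqVneq z x') => [->|_] /=; first by rewrite x'A.
    by case: (eqVneq z y') => [->|_]; rewrite ?andbF // (negbTE y'A).
  have BZ : B :&: Z = [set y; y'].
    apply/setP=> z; rewrite !inE; case: (eqVneq z x) => [->|_] /=.
      by rewrite (negbTE xB) (negbTE nxy) eq_sym (negbTE ny'x).
    case: (eqVneq z y) => [->|_] /=; first by rewrite yB.
    case: (eqVneq z x') => [->|_] /=; first by rewrite (negbTE x'B) (negbTE nxy').
    by case: (eqVneq z y') => [->|_]; rewrite ?andbF // y'B.
  have [s|A' [B' [hA' hB0' A'Z B'Z eZ]]] := stable_confluence st hA hB0.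
    move/in_prodP/(_ s): (hP _ hA); move/in_prodP/(_ s): (hP _ hB0) => <-.
    rewrite (count_setD A Z) (count_setD B Z) AZ BZ /count.
    rewrite !big_setU1 ?inE 1?eq_sym //= !big_set1.
    by rewrite exy' => /addnI.
  have x'B' : x' \notin B'.
    move/setP/(_ x'): B'Z; rewrite BZ !inE eqxx !orbT andbT => ->.
    by rewrite negb_or nx'y nxy'.
  have [_ /negP[]] := hB' _ hB0' x'B'.
  suff -> : x' |: B' :\ y' = A' by [].
  apply/setP=> z; move/setP/(_ z): eZ; move/setP/(_ z): A'Z.
  move/setP/(_ z): B'Z; rewrite AZ BZ !inE.
  case: (eqVneq z x') => [_|_] /=; first by rewrite !orbT !andbT => _ ->.
  case: (eqVneq z y') => [->|_] /=; first by rewrite !orbT !andbT (negbTE ny'y) => _ ->.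
  rewrite !orbF; case: (_ || _) => /=; last by move=> _ _ ->.
  by rewrite !andbT => -> ->.
have [F hF xF] := hN x; have [yF nF1] := hB _ hF xF.
pose F1 := x |: (F :\ y).
(* As [F1] is not a member, maximality gives a member [G] disjoint from it. Hence [G] also contains
   [y] and not [x], and has the opposite choice between [x'] and [y']. *)
have [G hG GF1] : exists2 G, G \in fam & G :&: F1 = set0.
  have [/exists_inP[G hG /eqP e]|/exists_inPn h] :=
    boolP [exists G in fam, G :&: F1 == set0]; first by exists G.
  case/negP: nF1; apply: (extremal_mem ext).
  - move/in_prodP: (hP _ hF) => cF.
    by apply/in_prodP => s; rewrite count_swap.
  - by apply/set0Pn; exists x; rewrite setU11.
  - exact: h.
have out z : z \in F1 -> z \notin G.
  by move=> zF; apply/negP => zG; move/setP/(_ z): GF1; rewrite inE zG zF inE.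
have xG : x \notin G by apply: out; rewrite setU11.
have [yG _] := hB _ hG xG.
case x'F: (x' \in F).
  have x'G : x' \notin G by apply: out; rewrite !inE nx'y x'F orbT.
  have [y'G _] := hB' _ hG x'G.
  apply: (key F G) => //; apply/negP => y'F.
  have := in_prod_uniq (hP _ hF) k1' erefl (esym exy') x'F y'F.
  by move/eqP; rewrite (negbTE nxy').
have [y'F _] := hB' _ hF (negbT x'F).
have y'G : y' \notin G by apply: out; rewrite !inE ny'y y'F orbT.
have x'G : x' \in G by apply: contraNT y'G => /(hB' _ hG)[].
by apply: (key G F); rewrite ?x'F.
Qed.

(** * Recoding coordinates in parts of size 1 *)

Definition replace c H := c |: [set z in H | tag z != tag c].

Lemma in_replace c H z :
  (z \in replace c H) = if tag z == tag c then z == c else z \in H.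
Proof.
rewrite !inE; have [_|nz] := eqVneq (tag z) (tag c); first by rewrite andbF orbF.
by rewrite andbT (_ : z == c = false) //; apply: contraNF nz => /eqP->.
Qed.

Lemma replace_in_prod c H : k (tag c) = 1 -> in_prod k H -> in_prod k (replace c H).
Proof.
move=> kc /in_prodP cH; apply/in_prodP=> s; rewrite -cH /count /replace.
rewrite big_setU1 ?inE ?eqxx ?andbF //=.
rewrite (eq_bigl (fun z => (z \in H) && (tag z != tag c))) => [|z]; last by rewrite inE.
rewrite big_mkcondr /=.
case: (eqVneq (tag c) s) => [<-|ns].
  rewrite [RHS]cH kc big1 // => z _; by case: eqP.
rewrite add0n; apply: eq_bigr => z _.
by case: (eqVneq (tag z) (tag c)) => [->|//]; rewrite (negbTE ns).
Qed.

Fact part_inhabited z : 0 < n (tag z).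
Proof. exact: leq_ltn_trans (leq0n _) (ltn_ord (tagged z)). Qed.

Definition first z : ground := elt (Ordinal (part_inhabited z)).

Lemma first_minimal x z : ~~ below x (first z).
Proof. by rewrite /below ltn0 andbF. Qed.

Lemma first_neq x y : below x y -> first x != y.
Proof. by apply: contraTneq => <-; apply: first_minimal. Qed.

(** Every member contains [x] or [y], and part size 1 leaves room for nothing else: its coordinate
    there is a single bit. *)
Lemma blocked_coord fam x y F z : blocked fam x y -> F \in fam -> in_prod k F ->
  k (tag x) = 1 -> tag z = tag x -> (z \in F) = (z == if y \in F then y else x).
Proof.
move=> [lxy hB] hF pF k1 ez; have /andP[/eqP exy _] := lxy.
set c := if _ then _ else _; have [cF ec] : c \in F /\ tag c = tag x.
  rewrite /c; case: ifP => // /negbT yF; split=> //.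
  by apply: contraNT yF => /(hB _ hF)[].
apply/idP/eqP => [zF|-> //]; exact: (in_prod_uniq pF k1).
Qed.

(* [fam] is disjoint from its image under exchanging [x1] and [y1], so a member
   is determined by its trace outside part [tag x1]; its coordinates in parts
   [tag x2] and [tag x3] are then re-encoded by one of the four patterns having
   at least two first elements. *)
Lemma blocked3 fam x1 y1 x2 y2 x3 y3 : nontriv fam ->
  blocked fam x1 y1 -> blocked fam x2 y2 -> blocked fam x3 y3 ->
  k (tag x1) = 1 -> k (tag x2) = 1 -> k (tag x3) = 1 ->
  tag x1 != tag x2 -> tag x1 != tag x3 -> tag x2 != tag x3 ->
  exists fam', [/\ nontriv fam', #|fam| <= #|fam'| & stable_off set0 fam'].
Proof.
move=> /nontrivP[hP _ hN] b1 b2 b3 k1 k2 k3 n12 n13 n23.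
have neq (u v : ground) : tag u != tag v -> u != v by apply: contraNneq => ->.
have n21 : tag x2 != tag x1 by rewrite eq_sym.
have n31 : tag x3 != tag x1 by rewrite eq_sym.
have n32 : tag x3 != tag x2 by rewrite eq_sym.
have [[/andP[/eqP e1 _] _] [/andP[/eqP e2 _] _]] := (b1, b2).
have [/andP[/eqP e3 _] _] := b3.
have [[l1 hB1] [l2 _] [l3 _]] := And3 b1 b2 b3.
have o1 := first_neq l1; have o2 := first_neq l2; have o3 := first_neq l3.
pose M := [set F | in_prod k F &&
  (1 < (first x1 \in F) + (first x2 \in F) + (first x3 \in F))].
exists M; split.
- apply/nontrivP; split.
  + by move=> F; rewrite inE => /andP[].
  + move=> F G; rewrite !inE => /andP[_ F2] /andP[_ G2].
    apply: contraTneq F2 => FG0.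
    have D o : (o \in F) + (o \in G) <= 1.
      by move/setP/(_ o): FG0; rewrite !inE; case: (o \in F); case: (o \in G).
    move: G2 (D (first x1)) (D (first x2)) (D (first x3)).
    by do 6![case: (_ \in _)].
  (* Overwrite, in a member avoiding [z], two of the three coordinates by first elements different
     from [z]. *)
  move=> z; have [H hH zH] := hN z.
  have notin c (L : {set ground}) : z != c -> z \notin L -> z \notin replace c L.
    by rewrite !inE => /negbTE-> /negbTE->.
  have [nz|nz] := boolP ((z != first x1) && (z != first x2)).
    exists (replace (first x1) (replace (first x2) H)).
      by rewrite inE !replace_in_prod ?hP //= !inE !eqxx /= n21 orbT.
    by case/andP: nz => nz1 nz2; do 2!apply: (notin) => //.
  exists (replace (first x3)
    (replace (if z == first x1 then first x2 else first x1) H)).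
    rewrite inE; case: ifP => _; rewrite !replace_in_prod ?hP //= !inE !eqxx /=.
      by rewrite n23 orbT -addnA; apply: leq_addl.
    by rewrite n13 orbT addnAC; apply: leq_addr.
  apply: (notin); last first.
    apply: (notin) => //; case: ifP => [/eqP->|/negbT //]; exact: neq.
  move: nz; rewrite negb_and !negbK => /orP[] /eqP->; exact: neq.
(* The bits of [F] at [y2] and [y3] select the pattern: no [y], or exactly one of [y1], [y2], [y3],
   all other coordinates being first. No [y] is first in its part, so the bits can be read back. *)
- pose c1 F := if (y2 \in F) && (y3 \in F) then y1 else first x1.
  pose c2 F := if (y2 \in F) && (y3 \notin F) then y2 else first x2.
  pose c3 F := if (y3 \in F) && (y2 \notin F) then y3 else first x3.
  have t1 F : tag (c1 F) = tag x1 by rewrite /c1; case: ifP.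
  have t2 F : tag (c2 F) = tag x2 by rewrite /c2; case: ifP.
  have t3 F : tag (c3 F) = tag x3 by rewrite /c3; case: ifP.
  pose psi F := replace (c1 F) (replace (c2 F) (replace (c3 F) F)).
  have psiE F z : (z \in psi F) = if tag z == tag x1 then z == c1 F
      else if tag z == tag x2 then z == c2 F
      else if tag z == tag x3 then z == c3 F else z \in F.
    by rewrite /psi !in_replace t1 t2 t3.
  have psi_inj : {in fam &, injective psi}.
    have mem1 F : (y1 \in psi F) = (y2 \in F) && (y3 \in F).
      by rewrite psiE -e1 eqxx /c1; case: ifP; rewrite ?eqxx // eq_sym (negbTE o1).
    have mem2 F : (y2 \in psi F) = (y2 \in F) && (y3 \notin F).
      rewrite psiE -e2 eqxx (negbTE n21) /c2.
      by case: ifP; rewrite ?eqxx // eq_sym (negbTE o2).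
    have mem3 F : (y3 \in psi F) = (y3 \in F) && (y2 \notin F).
      rewrite psiE -e3 eqxx (negbTE n31) (negbTE n32) /c3.
      by case: ifP; rewrite ?eqxx // eq_sym (negbTE o3).
    have agree F G : F \in fam -> G \in fam -> psi F = psi G ->
        forall z, tag z != tag x1 -> (z \in F) = (z \in G).
      move=> hF hG e z nz1.
      have [y2E y3E] : (y2 \in F) = (y2 \in G) /\ (y3 \in F) = (y3 \in G).
        have := mem1 F; have := mem2 F; have := mem3 F; rewrite e mem1 mem2 mem3.
        by case: (y2 \in F); case: (y3 \in F); case: (y2 \in G); case: (y3 \in G).
      have [ez|nz2] := eqVneq (tag z) (tag x2).
        by rewrite (blocked_coord b2 hF) ?hP // (blocked_coord b2 hG) ?hP // y2E.
      have [ez|nz3] := eqVneq (tag z) (tag x3).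
        by rewrite (blocked_coord b3 hF) ?hP // (blocked_coord b3 hG) ?hP // y3E.
      move/setP/(_ z): e; rewrite !psiE.
      by rewrite (negbTE nz1) (negbTE nz2) (negbTE nz3).
    (* The bit at [y1] is the only one not encoded; two members differing only there would be
       exchanges of each other, which the first pair forbids. *)
    have clash F G : F \in fam -> G \in fam -> psi F = psi G ->
        y1 \in F -> y1 \notin G -> False.
      move=> hF hG e yF yG; have coord := blocked_coord b1.
      have nxy := below_neq l1.
      have xF : x1 \notin F by rewrite (coord F) ?hP // yF.
      have [_ /negP[]] := hB1 _ hF xF.
      suff -> : x1 |: F :\ y1 = G by [].
      apply/setP=> z; rewrite !inE; have [ez|nz] := eqVneq (tag z) (tag x1).
        rewrite (coord F) ?hP // (coord G) ?hP // yF (negbTE yG).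
        by case: (z == y1); rewrite ?orbF.
      rewrite (agree _ _ hF hG e) //.
      have -> : z == x1 = false by apply: contraNF nz => /eqP->.
      by have -> : z == y1 = false by apply: contraNF nz => /eqP->; rewrite e1.
    move=> F G hF hG e; apply/setP=> z.
    have [ez|nz] := eqVneq (tag z) (tag x1); last exact: agree.
    rewrite (blocked_coord b1 hF) ?hP // (blocked_coord b1 hG) ?hP //.
    case yF: (y1 \in F); case yG: (y1 \in G) => //.
      by case: (clash F G); rewrite ?yG.
    by case: (clash G F); rewrite ?yF.
  rewrite -(card_in_imset psi_inj); apply/subset_leq_card/subsetP=> _ /imsetP[F hF ->].
  rewrite inE !replace_in_prod ?hP ?t1 ?t2 ?t3 //= !psiE !eqxx.
  rewrite (negbTE n21) (negbTE n31) (negbTE n32) /c1 /c2 /c3.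
  by case: (y2 \in F); case: (y3 \in F) => /=;
    rewrite !eqxx ?(negbTE o1) ?(negbTE o2) ?(negbTE o3).
- apply/forallP => x; apply/forallP => y; apply/implyP => /and3P[lxy _ _].
  apply/forall_inP => F; rewrite !inE => /andP[/in_prodP pF F2].
  have /andP[/eqP exy _] := lxy.
  (* A shift removes only its upper element, which is never first in its part. *)
  have up o : (first o \in F) <= (first o \in shift x y F).
    rewrite /shift; case: ifP => // _; rewrite !inE.
    have -> : first o != y by apply: contraTneq lxy => <-; apply: first_minimal.
    by case: (_ \in F); rewrite ?orbT.
  apply/andP; split; first by apply/in_prodP => s; rewrite count_shift.
  by apply: (leq_trans F2); rewrite !leq_add.
Qed.

(** * Assembling the shifted maximum family *)

Lemma stable_off0_shifted fam : stable_off set0 fam -> shifted fam.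
Proof.
move=> /forallP st t i j lij; apply: (@shiftf_id (elt i) (elt j)) => F hF.
have /forallP/(_ (elt j)) := st (elt i).
by rewrite !inE /below eqxx /idx /= lij => /forall_inP; apply.
Qed.

(** If [fam] is not stable, failures of stability off the empty set, off one pair and off two pairs
    yield three disjoint blocked pairs, in distinct parts of size 1. *)
Lemma extremal_shifted fam : extremal fam ->
  exists fam', [/\ nontriv fam', #|fam| <= #|fam'| & stable_off set0 fam'].
Proof.
move=> ext; have [nt _ _] := ext.
have [st|/(stable_or_blocked ext)[x1 [y1 [b1 _ _]]]] := boolP (stable_off set0 fam).
  by exists fam.
have [x2 [y2 [b2 dx2 dy2]]] := stable_or_blocked ext (blocked_not_stable ext b1).
have [x3 [y3 [b3 dx3 dy3]]] :=
  stable_or_blocked ext (blocked2_not_stable ext b1 b2 dx2 dy2).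
have [k1 k2 n12] := blocked_pairs ext b1 b2 dx2 dy2.
have sub z : z \notin [set x1; y1; x2; y2] ->
    z \notin [set x1; y1] /\ z \notin [set x2; y2].
  by rewrite !inE !negb_or -!andbA => /and4P[-> -> -> ->].
have [[dx31 dx32] [dy31 dy32]] := (sub _ dx3, sub _ dy3).
have [_ k3 n13] := blocked_pairs ext b1 b3 dx31 dy31.
have [_ _ n23] := blocked_pairs ext b2 b3 dx32 dy32.
exact: (blocked3 nt b1 b2 b3).
Qed.

End Shifting.

Theorem theorem2p1 (p : nat) (n : 'I_p -> nat) (k : 'I_p -> nat) :
  0 < p ->
  (forall s, 1 <= n s) ->
  (forall s, 1 <= k s <= n s) ->
  (exists fam : {set {set ground n}},
      subfam_prod k fam /\ nontrivially_intersecting fam) ->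
  exists fam' : {set {set ground n}},
    [/\ subfam_prod k fam', nontrivially_intersecting fam',
        (forall G : {set {set ground n}},
            subfam_prod k G -> nontrivially_intersecting G -> #|G| <= #|fam'|)
      & shifted fam'].
Proof.
move=> _ _ _ [fam0 /nontrivE /extremal_exists[fam ext]].
have [_ hmax _] := ext.
have [fam' [/nontrivE[h1 h2] le st]] := extremal_shifted ext.
exists fam'; split=> //; last exact: (stable_off0_shifted st).
by move=> G hG nG; apply: (leq_trans _ le); apply/hmax/nontrivE.
Qed.
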